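(* Suppose the nonidentity elements of a finite group $G$ are partitioned into partial difference sets $P_1,P_2,\dots,P_n$ all of Latin square type or all of negative Latin square type. Then the quadratic group ring relations relating the $P_i$ and $P_j$ are determined by the parameters and do not depend on whether the group is abelian or not. Precisely: if $\widehat{G}$ is any finite group whose nonidentity elements are partitioned into partial difference sets $\widehat{P_1},\dots,\widehat{P_n}$ such that $P_i$ and $\widehat{P_i}$ have the same parameters for every $i$, then for all $i,j\in\{1,\dots,n\}$ there are integers $c_0,c_1,\dots,c_n$ (depending on $i,j$) such that $$P_iP_j=c_0 1_G+\sum_{k=1}^n c_kP_k\ \text{ in }\mathbb{Z}[G]\qquad\text{and}\qquad \widehat{P_i}\widehat{P_j}=c_0 1_{\widehat{G}}+\sum_{k=1}^n c_k\widehat{P_k}\ \text{ in }\mathbb{Z}[\widehat{G}].$$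
   Context: A $(v,k,\lambda,\mu)$-partial difference set (PDS) in a finite group $G$ of order $v$ is a subset $D$ with $|D|=k$ such that every nonidentity element of $D$ can be written as $d_1d_2^{-1}$ with $d_1,d_2\in D$ in exactly $\lambda$ ways, and every nonidentity element of $G-D$ in exactly $\mu$ ways. PDSs are assumed regular: $1_G\notin D$ and $D=D^{-1}$. A PDS is of Latin square type if its parameters are $(n^2,r(n-1),n+r^2-3r,r^2-r)$ for some natural number $r$, and of negative Latin square type if they are $(n^2,r(n+1),-n+r^2+3r,r^2+r)$ for some natural number $r$. A subset $D$ of $G$ is identified with the element $\sum_{d\in D}d$ of the group ring $\mathbb{Z}[G]$. *)

(* Defs.v *)
From HB Require Import structures.
From mathcomp Require Import all_boot all_order all_algebra all_fingroup.

Set Implicit Arguments.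
Unset Strict Implicit.
Unset Printing Implicit Defensive.

Import GRing.Theory.

Local Open Scope ring_scope.

(* The integral group ring Z[G] of the finite group G carried by gT.  The type
   is an alias of {ffun gT -> int}, so that multiplication is the convolution
   product rather than the pointwise product MathComp puts on {ffun gT -> int}.
   (mxrepresentation.group_ring encodes the group ring by matrices, and the
   monoid algebras of multinomials do not allow nontrivial invertible
   monomials.) *)
Definition zgroup_ring (gT : finGroupType) : Type := {ffun gT -> int}.

Section GroupRing.
Variable gT : finGroupType.
Implicit Types (a b c : zgroup_ring gT) (g h : gT).

HB.instance Definition _ := GRing.Zmodule.on (zgroup_ring gT).

Definition gr_elt g : zgroup_ring gT := [ffun h => (h == g)%:R].

Definition gr_mul a b : zgroup_ring gT :=
  [ffun g => \sum_h a h * b (h^-1 * g)%g].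

Lemma gr_mulA : associative gr_mul.
Proof.
move=> a b c; apply/ffunP=> g; rewrite !ffunE.
transitivity (\sum_h \sum_k a h * (b (h^-1 * k)%g * c (k^-1 * g)%g)).
  apply: eq_bigr => h _; rewrite ffunE mulr_sumr.
  rewrite (reindex_inj (mulgI h^-1%g)) /=; apply: eq_bigr => k _.
  by rewrite invMg invgK -mulgA mulKVg.
rewrite exchange_big; apply: eq_bigr => k _; rewrite ffunE mulr_suml.
by apply: eq_bigr => h _; rewrite mulrA.
Qed.

Lemma gr_mul1 : left_id (gr_elt 1%g) gr_mul.
Proof.
move=> a; apply/ffunP=> g; rewrite ffunE (bigD1 1%g) //= ffunE eqxx mul1r.
rewrite invg1 mul1g big1 ?addr0 // => h /negPf h1.
by rewrite ffunE h1 mul0r.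
Qed.

Lemma gr_mulr1 : right_id (gr_elt 1%g) gr_mul.
Proof.
move=> a; apply/ffunP=> g; rewrite ffunE (bigD1 g) //= ffunE mulVg eqxx mulr1.
rewrite big1 ?addr0 // => h hg; rewrite ffunE.
by rewrite -(inj_eq (mulgI h)) mulKVg mulg1 eq_sym (negPf hg) mulr0.
Qed.

Lemma gr_mulDl : left_distributive gr_mul +%R.
Proof.
move=> a b c; apply/ffunP=> g; rewrite !ffunE -big_split /=.
by apply: eq_bigr => h _; rewrite ffunE mulrDl.
Qed.

Lemma gr_mulDr : right_distributive gr_mul +%R.
Proof.
move=> a b c; apply/ffunP=> g; rewrite !ffunE -big_split /=.
by apply: eq_bigr => h _; rewrite ffunE mulrDr.
Qed.

Lemma gr_elt1_neq0 : gr_elt 1%g != 0.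
Proof. by apply/eqP=> /ffunP/(_ 1%g); rewrite !ffunE eqxx. Qed.

HB.instance Definition _ := GRing.Zmodule_isNzRing.Build (zgroup_ring gT)
  gr_mulA gr_mul1 gr_mulr1 gr_mulDl gr_mulDr gr_elt1_neq0.

Lemma gr_elt1 : gr_elt 1%g = 1.
Proof. by []. Qed.

Lemma gr_eltM g h : gr_elt (g * h)%g = gr_elt g * gr_elt h.
Proof.
apply/ffunP=> k; rewrite [RHS]ffunE ffunE (bigD1 g) //= !ffunE eqxx mul1r.
rewrite big1 ?addr0 => [|i /negPf ig]; last by rewrite ffunE ig mul0r.
by rewrite -[in RHS](inj_eq (mulgI g)) mulKVg.
Qed.

Definition gr_set (D : {set gT}) : zgroup_ring gT := \sum_(d in D) gr_elt d.

End GroupRing.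

Record pds_params := PdsParams {
  pds_v : nat;
  pds_k : nat;
  pds_lambda : nat;
  pds_mu : nat
}.

Definition diff_count (gT : finGroupType) (D : {set gT}) (g : gT) : nat :=
  #|[set d in setX D D | d.1 * d.2^-1 == g]%g|.

Definition is_pds (gT : finGroupType) (p : pds_params) (D : {set gT}) : Prop :=
  [/\ #|[set: gT]| = pds_v p,
      #|D| = pds_k p,
      forall g : gT, g != 1%g -> g \in D -> diff_count D g = pds_lambda p,
      forall g : gT, g != 1%g -> g \notin D -> diff_count D g = pds_mu p
    & (1%g \notin D) /\ D = (D^-1)%g].

(* The equations are stated in int, where subtraction is not truncated. *)
Definition latin_square_type (p : pds_params) : Prop :=
  exists n r : nat,
    [/\ (pds_v p)%:Z = n%:Z ^+ 2,
        (pds_k p)%:Z = r%:Z * (n%:Z - 1),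
        (pds_lambda p)%:Z = n%:Z + r%:Z ^+ 2 - 3 * r%:Z
      & (pds_mu p)%:Z = r%:Z ^+ 2 - r%:Z].

Definition negative_latin_square_type (p : pds_params) : Prop :=
  exists n r : nat,
    [/\ (pds_v p)%:Z = n%:Z ^+ 2,
        (pds_k p)%:Z = r%:Z * (n%:Z + 1),
        (pds_lambda p)%:Z = - n%:Z + r%:Z ^+ 2 + 3 * r%:Z
      & (pds_mu p)%:Z = r%:Z ^+ 2 + r%:Z].

(* Injectivity of P is needed because the image set forgets repeated blocks. *)
Definition partitions_nonidentity (gT : finGroupType) (n : nat)
    (P : 'I_n -> {set gT}) : Prop :=
  injective P /\ partition [set P i | i : 'I_n] [set~ 1%g].

(* Main.v *)
Require Import Defs.
From HB Require Import structures.
From mathcomp Require Import all_boot all_order all_algebra all_fingroup.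
From mathcomp Require Import ring.

(** Latin square and negative Latin square parameters are a single family:
  a negative Latin square set with parameters [n, r] has the Latin square
  equations for [m = - n] and [- r], so it suffices to treat [m, r] in [int].

  Write [G] for the sum of all group elements.  The quadratic equation of a
  Latin square set [P] becomes [(P + r)^2 = (P + r) m + G (r^2 - r)], so modulo
  the ideal spanned by [G] the element [(P + r) / m] is idempotent.  For a
  partition, counting elements gives [\sum_i r_i = m + 1], hence modulo [G] these
  idempotents add up to [1].  They are moreover self-adjoint for the involution
  [g |-> g^-1] because [P = P^-1].  Self-adjoint idempotents [e_i] with sum [1]
  are orthogonal: [e_j = e_j (\sum_i e_i) e_j] yields
  [\sum_(i != j) (e_i e_j)^* (e_i e_j) = 0], and the coefficient of [1] in
  [x^* x] is the sum of the squares of the coefficients of [x].  No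
  commutativity enters.  Undoing the reduction modulo [G],
  [(P_i + r_i) (P_j + r_j) = G (r_i r_j)] for [i != j], in which only the
  parameters occur.

  To stay in the integral group ring, [e_i] is replaced by its multiple
  [F_i = (P_i + r_i) m - G r_i], which satisfies [F_i^2 = F_i m^2] and
  [F_i G = 0] ([square_partition_idem]); [orth_of_sym_idem] is the orthogonality
  argument, and [square_partition_mul] the resulting product formula. *)

Set Implicit Arguments.
Unset Strict Implicit.
Unset Printing Implicit Defensive.

Import Order.TTheory GRing.Theory Num.Theory.
Local Open Scope ring_scope.

(** * Coefficients in the integral group ring *)

Section GroupRingCoefficients.
Variable gT : finGroupType.
Implicit Types (x y : zgroup_ring gT) (g : gT) (D : {set gT}).

Lemma gr_mulE x y g : (x * y) g = \sum_h x h * y (h^-1 * g)%g.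
Proof. by rewrite [LHS]ffunE. Qed.

Lemma gr_oneE g : (1 : zgroup_ring gT) g = (g == 1%g)%:R.
Proof. by rewrite -gr_elt1 ffunE. Qed.

Lemma gr_addE x y g : (x + y) g = x g + y g.
Proof. by rewrite ffunE. Qed.

Lemma gr_oppE x g : (- x) g = - x g.
Proof. by rewrite ffunE. Qed.

Lemma gr_sumE (I : Type) (r : seq I) (A : pred I) (F : I -> zgroup_ring gT) g :
  (\sum_(i <- r | A i) F i) g = \sum_(i <- r | A i) F i g.
Proof.
by apply: (big_morph (fun x : zgroup_ring gT => x g)) => [x y|]; rewrite ffunE.
Qed.

Lemma gr_mulrzE x (c : int) g : (x *~ c) g = x g * c.
Proof.
have mulrnE (n : nat) : (x *+ n) g = x g * n%:Z.
  by rewrite -natz mulr_natr; elim: n => [|n IHn]; rewrite ?ffunE // !mulrS ffunE IHn.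
case: c => n; first exact: mulrnE.
by rewrite NegzE mulrNz gr_oppE mulrnE mulrN.
Qed.

Definition gr_coefE := (gr_addE, gr_oppE, gr_mulrzE, gr_oneE).

Lemma gr_setE D g : gr_set D g = (g \in D)%:R.
Proof.
rewrite /gr_set gr_sumE; case: (boolP (g \in D)) => gD.
  rewrite (bigD1 g) //= ffunE eqxx big1 ?addr0 // => h /andP[_ hg].
  by rewrite ffunE eq_sym (negPf hg).
rewrite big1 // => h hD; rewrite ffunE; case: eqP => // gh.
by rewrite gh hD in gD.
Qed.

Lemma sum_gr_set D : \sum_g gr_set D g = #|D|%:Z.
Proof.
rewrite -natz -sumr_const [RHS]big_mkcond; apply: eq_bigr => g _.
by rewrite gr_setE; case: (g \in D).
Qed.

Lemma gr_mulr_setT x : x * gr_set [set: gT] = gr_set [set: gT] *~ \sum_g x g.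
Proof.
apply/ffunP=> g; rewrite gr_mulE gr_mulrzE gr_setE inE mul1r.
by apply: eq_bigr => h _; rewrite gr_setE inE mulr1.
Qed.

Lemma gr_mull_setT x : gr_set [set: gT] * x = gr_set [set: gT] *~ \sum_g x g.
Proof.
apply/ffunP=> g; rewrite gr_mulE gr_mulrzE gr_setE inE mul1r.
rewrite [RHS](reindex_inj (inj_comp (mulIg g) invg_inj)) /=.
by apply: eq_bigr => h _; rewrite gr_setE inE mul1r.
Qed.

(** * Self-adjoint idempotents *)

(** Being fixed by the linear extension of [g |-> g^-1]. *)
Definition gr_sym x := forall g, x g^-1%g = x g.

Lemma gr_mul_symV x y g : gr_sym x -> gr_sym y -> (x * y) g^-1%g = (y * x) g.
Proof.
move=> symx symy; rewrite !gr_mulE.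
rewrite [RHS](reindex_inj (mulgI g)) /=; apply: eq_bigr => h _.
by rewrite -[y (g * h)%g]symy -[x (_ * g)%g]symx !invMg !invgK mulKg mulrC.
Qed.

(** For self-adjoint factors the left side is the coefficient of [1] in
  [z^* z] with [z = x * y], whence a sum of squares. *)
Lemma gr_sym_norm x y : gr_sym x -> gr_sym y ->
  (y * x * (x * y)) 1%g = \sum_g (y * x) g ^+ 2.
Proof.
move=> symx symy; rewrite gr_mulE; apply: eq_bigr => g _.
by rewrite mulg1 gr_mul_symV.
Qed.

(** The last hypothesis, instead of [\sum_i F i = s], lets the [F i] add up to a
  multiple of the identity on the ideal that they generate only. *)
Lemma orth_of_sym_idem (n : nat) (F : 'I_n -> zgroup_ring gT) (s : int) :
  s != 0 -> (forall i, gr_sym (F i)) -> (forall i, F i * F i = F i *~ s) ->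
  (forall j, F j * (\sum_i F i) = F j *~ s) ->
  forall i j, i != j -> F j * F i = 0.
Proof.
move=> s0 symF idemF sumF i j ij.
have sum0 : \sum_(k | k != j) (F j * F k * (F k * F j)) 1%g = 0.
  rewrite -gr_sumE.
  (* The whole sum and its term at [j] are both [(F j *~ s) * F j]. *)
  have -> : \sum_(k | k != j) F j * F k * (F k * F j) =
            (\sum_(k | k != j) F j * F k * F j) *~ s.
    rewrite mulrz_suml; apply: eq_bigr => k _.
    by rewrite mulrA -[F j * F k * F k]mulrA idemF mulrzAr mulrzAl.
  have := congr1 (fun x => x * F j) (sumF j).
  rewrite /= mulr_sumr mulr_suml (bigD1 j) //= idemF => /(canRL (addKr _)) ->.
  by rewrite addNr mul0rz ffunE.
move/eqP: sum0; rewrite psumr_eq0 => [/allP sum0|k _]; last first.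
  by rewrite gr_sym_norm //; apply: sumr_ge0 => g _; apply: sqr_ge0.
have /implyP/(_ ij) := sum0 i (mem_index_enum i).
rewrite gr_sym_norm // psumr_eq0 => [/allP sq0|g _]; last exact: sqr_ge0.
apply/ffunP=> g; rewrite [RHS]ffunE; apply/eqP.
by rewrite -sqrf_eq0; apply: (implyP (sq0 g (mem_index_enum g))).
Qed.

(** * Partial difference sets in the group ring *)

Lemma gr_set_sym D : D = (D^-1)%g -> gr_sym (gr_set D).
Proof. by move=> DV g; rewrite !gr_setE {1}DV inE invgK. Qed.

Lemma gr_set_sqrE D g : D = (D^-1)%g ->
  (gr_set D * gr_set D) g = (diff_count D g)%:Z.
Proof.
move=> DV; rewrite gr_mulE /diff_count.
pose A := [set h in D | (h^-1 * g)%g \in D].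
have -> : [set d in setX D D | d.1 * d.2^-1 == g]%g =
          [set (h, (g^-1 * h)%g) | h in A].
  apply/setP=> -[a b]; rewrite !inE /=; apply/idP/imsetP => [|[h]].
    case/andP=> /andP[aD bD] /eqP gE; exists a; last first.
      by rewrite -gE invMg invgK mulgKV.
    by rewrite !inE aD -gE mulKg DV inE invgK.
  rewrite !inE => /andP[hD hgD] [-> ->]; rewrite hD invMg invgK mulKVg eqxx.
  by rewrite andbT DV inE invMg invgK.
rewrite card_imset => [|h h' [] //].
rewrite -natz -sumr_const [RHS]big_mkcond; apply: eq_bigr => h _.
by rewrite !gr_setE inE; case: (h \in D); case: (_ \in D).
Qed.

Lemma pds_sqr p D : is_pds p D ->
  gr_set D * gr_set D = 1 *~ ((pds_k p)%:Z - (pds_mu p)%:Z)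
    + gr_set D *~ ((pds_lambda p)%:Z - (pds_mu p)%:Z)
    + gr_set [set: gT] *~ (pds_mu p)%:Z.
Proof.
case=> _ cardD countD countDC [D1 DV]; apply/ffunP=> g.
rewrite !gr_coefE !gr_setE inE.
have [->|g1] := eqVneq g 1%g.
  rewrite (negPf D1) gr_mulE -cardD -sum_gr_set.
  under eq_bigr => h _ do rewrite mulg1 gr_set_sym // gr_setE -natrM mulnb andbb.
  under [in RHS]eq_bigr => h _ do rewrite gr_setE.
  by rewrite mulr0n mulr1n; ring.
rewrite gr_set_sqrE //; case: (boolP (g \in D)) => gD.
  by rewrite countD // mulr0n !mulr1n; ring.
by rewrite countDC // mulr0n !mulr1n; ring.
Qed.

End GroupRingCoefficients.

(** * Partitions into sets of (negative) Latin square type *)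

(** Latin square type for [m, r >= 0], negative Latin square type for
  [m, r <= 0]. *)
Definition square_params (m r : int) (p : pds_params) : Prop :=
  [/\ (pds_v p)%:Z = m ^+ 2,
      (pds_k p)%:Z = r * (m - 1),
      (pds_lambda p)%:Z = m + r ^+ 2 - 3 * r
    & (pds_mu p)%:Z = r ^+ 2 - r].

(** The order [v = m ^+ 2] fixes [m] up to sign, and the common type fixes the
  sign. *)
Lemma square_params_of_type (n : nat) (p : 'I_n -> pds_params) (v : nat) :
  (forall i, pds_v (p i) = v) ->
  (forall i, latin_square_type (p i)) \/
    (forall i, negative_latin_square_type (p i)) ->
  'I_n -> exists (m : int) (r : 'I_n -> int),
    forall i, square_params m (r i) (p i).
Proof.
have sqr_inj (a b : nat) : a%:Z ^+ 2 = b%:Z ^+ 2 -> a = b.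
  by move/eqP; rewrite eqrXn2 // => /eqP[].
move=> vE [] typeP i0; have [m [_ [vm _ _ _]]] := typeP i0.
  exists m%:Z.
  suff /fin_all_exists : forall i, exists r : int, square_params m r (p i) by [].
  move=> i; have [m' [r [vm' kE lE muE]]] := typeP i.
  have mm' : m = m' by apply: sqr_inj; rewrite -vm -vm' !vE.
  by rewrite -mm' in vm' kE lE; exists r%:Z.
exists (- m%:Z).
suff /fin_all_exists : forall i, exists r : int, square_params (- m%:Z) r (p i) by [].
move=> i; have [m' [r [vm' kE lE muE]]] := typeP i.
have mm' : m = m' by apply: sqr_inj; rewrite -vm -vm' !vE.
rewrite -mm' in vm' kE lE; exists (- r%:Z).
by split; rewrite ?vm' ?kE ?lE ?muE; ring.
Qed.

Section SquarePartition.
Variables (gT : finGroupType) (n : nat) (P : 'I_n -> {set gT}).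
Variables (p : 'I_n -> pds_params) (m : int) (r : 'I_n -> int).
Hypothesis partP : partitions_nonidentity P.
Hypothesis pdsP : forall i, is_pds (p i) (P i).
Hypothesis paramP : forall i, square_params m (r i) (p i).

Let G := gr_set [set: gT].

Lemma sum_partition_nonidentity : \sum_i gr_set (P i) = G - 1.
Proof.
have [injP /and3P[/eqP coverP trivP _]] := partP.
apply/ffunP=> g; rewrite gr_sumE !gr_coefE gr_setE inE.
under eq_bigr => i _ do rewrite gr_setE.
have gP : (g \in cover [set P i | i : 'I_n]) = (g != 1%g) by rewrite coverP !inE.
have [g1|g1] := boolP (g == 1%g).
  rewrite big1 // => i _; case: (boolP (g \in P i)) => // gPi.
  suff : g \in cover [set P i | i : 'I_n] by rewrite gP g1.
  by apply/bigcupP; exists (P i) => //; apply: imset_f.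
move: gP; rewrite g1 => /bigcupP[_ /imsetP[i _ ->] gPi].
rewrite (bigD1 i) //= gPi big1 ?addr0 // => j ji.
have PjPi : [disjoint P j & P i].
  apply: (trivIsetP trivP); rewrite ?imset_f //.
  by apply: contra ji => /eqP/injP ->.
case: (boolP (g \in P j)) => // gPj.
by move/pred0P: PjPi => /(_ g); rewrite /= gPj gPi.
Qed.

Lemma square_partition_card (i : 'I_n) : #|[set: gT]|%:Z = m ^+ 2.
Proof. by have [-> _ _ _ _] := pdsP i; have [] := paramP i. Qed.

Lemma square_partition_neq0 (i : 'I_n) : m != 0.
Proof.
by rewrite -sqrf_eq0 -(square_partition_card i) eqz_nat -lt0n; apply/card_gt0P; exists 1%g.
Qed.

(** [m = 1] would make the group trivial, leaving no room for a block. *)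
Lemma square_partition_neq1 (i : 'I_n) : m != 1.
Proof.
apply/eqP=> m1; have := square_partition_card i; rewrite m1 expr1n => -[card1].
have [_ /and3P[_ _ P0]] := partP.
case/negP: P0; suff -> : set0 = P i by apply: imset_f.
apply/esym/setP=> g; rewrite inE.
have [_ _ _ _ [Pi1 _]] := pdsP i.
have -> : g = 1%g; last exact: negPf.
have /cards1P[x xP] : #|[set: gT]| == 1%N by rewrite card1.
have := in_setT g; have := in_setT (1%g : gT).
by rewrite xP !inE => /eqP -> /eqP ->.
Qed.

Lemma sum_square_params (i : 'I_n) : \sum_k r k = m + 1.
Proof.
have m1 : m - 1 != 0 by rewrite subr_eq0 (square_partition_neq1 i).
apply: (mulIf m1); rewrite mulr_suml.
have -> : \sum_k r k * (m - 1) = \sum_k \sum_g gr_set (P k) g.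
  apply: eq_bigr => k _; rewrite sum_gr_set.
  by have [_ -> _ _ _] := pdsP k; have [_ -> _ _] := paramP k.
rewrite exchange_big /=; under eq_bigr => g _ do
  rewrite -gr_sumE sum_partition_nonidentity !gr_coefE.
rewrite sumrB sum_gr_set (square_partition_card i).
have -> : \sum_(g : gT) (g == 1%g)%:R = 1 :> int.
  by rewrite (bigD1 1%g) //= eqxx big1 ?addr0 // => g /negPf ->.
by ring.
Qed.

(** The eigenvalues of [P i] off the trivial part are [m - r i] and [- r i];
  this shift makes them [m] and [0]. *)
Let X i := gr_set (P i) + 1 *~ r i.

Lemma shift_mulG i : X i * G = G *~ (r i * m) /\ G * X i = G *~ (r i * m).
Proof.
have [_ cardP _ _ _] := pdsP i; have [_ kE _ _] := paramP i.
suff sumX : \sum_g X i g = r i * m by rewrite gr_mulr_setT gr_mull_setT sumX.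
under eq_bigr => g _ do rewrite !gr_coefE.
rewrite big_split /= sum_gr_set cardP kE.
rewrite (bigD1 (1%g : gT)) //= big1 => [|g /negPf ->]; last by rewrite mul0r.
by rewrite eqxx mulr1n; ring.
Qed.

Lemma shift_sqr i : X i * X i = X i *~ m + G *~ (r i ^+ 2 - r i).
Proof.
have [_ kE lE muE] := paramP i.
rewrite /X mulrDl !mulrDr !mulrzAl !mulrzAr !mulr1 mul1r.
rewrite (pds_sqr (pdsP i)) kE lE muE -/G.
by apply/ffunP=> g; rewrite !gr_coefE; ring.
Qed.

(** [m ^+ 2] times the idempotent of [P i], with its trivial part removed. *)
Let F i := X i *~ m - G *~ r i.

Lemma square_partition_sqrG (i : 'I_n) : G * G = G *~ m ^+ 2.
Proof. by rewrite gr_mulr_setT sum_gr_set (square_partition_card i). Qed.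

Lemma square_partition_idem i : F i * F i = F i *~ m ^+ 2 /\ F i * G = 0.
Proof.
have [XG GX] := shift_mulG i; have GG := square_partition_sqrG i.
split; rewrite /F mulrBl ?mulrBr ?mulrzAl ?mulrzAr ?XG ?GX ?GG ?shift_sqr;
  apply/ffunP=> g; rewrite ?gr_coefE ?[RHS]ffunE; by ring.
Qed.

Lemma sum_square_partition_idem (i : 'I_n) : \sum_k F k = 1 *~ m ^+ 2 - G.
Proof.
rewrite sumrB -mulrz_sumr -mulrz_suml big_split /= sum_partition_nonidentity.
by rewrite -mulrz_sumr (sum_square_params i); apply/ffunP=> g; rewrite !gr_coefE; ring.
Qed.

Lemma square_partition_idem_sym i : gr_sym (F i).
Proof.
have [_ _ _ _ [_ PV]] := pdsP i => g.
by rewrite !gr_coefE gr_set_sym // !gr_setE !inE -eq_invg1 invgK.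
Qed.

(** Expands [F j * F i = 0] and divides by [m ^+ 2]. *)
Lemma shift_orth i j : i != j -> X j * X i = G *~ (r i * r j).
Proof.
move=> ij; have m2 : m ^+ 2 != 0 by rewrite sqrf_eq0 (square_partition_neq0 i).
have FF0 : F j * F i = 0.
  apply: (orth_of_sym_idem m2) ij => [k|k|k].
  - exact: square_partition_idem_sym.
  - by case: (square_partition_idem k).
  - rewrite (sum_square_partition_idem k) mulrBr mulrzAr mulr1.
    by case: (square_partition_idem k) => _ ->; rewrite subr0.
have [XG _] := shift_mulG j; have [_ GX] := shift_mulG i.
have GG := square_partition_sqrG i.
apply/ffunP=> g; apply: (mulIf m2).
have := congr1 (fun x : zgroup_ring gT => x g) FF0.
rewrite /F mulrBl !mulrBr !mulrzAl !mulrzAr XG GX GG !gr_coefE [RHS]ffunE => FF0g.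
rewrite -[LHS]subr0 -FF0g; ring.
Qed.

Lemma square_partition_mul i j :
  gr_set (P i) * gr_set (P j) = 1 *~ ((i == j)%:R * (r i * (m - 1))) +
    \sum_k gr_set (P k) *~ ((k == i)%:R * ((i == j)%:R * m - r j)
      - (k == j)%:R * r i + (r i * r j - (i == j)%:R * r i)).
Proof.
have XX : X i * X j = (X i *~ m - G *~ r i) *~ (i == j)%:R + G *~ (r i * r j).
  have [<-|ij] := eqVneq i j; last first.
    by rewrite shift_orth 1?eq_sym // mulr0z add0r mulrC.
  by rewrite shift_sqr mulr1n; apply/ffunP=> g; rewrite !gr_coefE; ring.
have PX k : gr_set (P k) = X k - 1 *~ r k by rewrite addrK.
under eq_bigr => k _ do rewrite mulrzDr mulrzBr.
rewrite big_split sumrB /= -mulrz_suml sum_partition_nonidentity.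
have pick l c : \sum_k gr_set (P k) *~ ((k == l)%:R * c) = gr_set (P l) *~ c.
  rewrite (bigD1 l) //= eqxx mul1r big1 ?addr0 // => k /negPf ->.
  by rewrite mul0r mulr0z.
rewrite !pick !PX mulrBl !mulrBr !mulrzAl !mulrzAr !mulr1 mul1r XX.
by apply/ffunP=> g; rewrite !gr_coefE; ring.
Qed.

End SquarePartition.

Theorem lemma6p1 (n : nat) (p : 'I_n -> pds_params)
    (gT : finGroupType) (P : 'I_n -> {set gT})
    (partP : partitions_nonidentity P)
    (pdsP : forall i, is_pds (p i) (P i))
    (typeP : (forall i, latin_square_type (p i)) \/
             (forall i, negative_latin_square_type (p i)))
    (hT : finGroupType) (Q : 'I_n -> {set hT})
    (partQ : partitions_nonidentity Q)
    (pdsQ : forall i, is_pds (p i) (Q i)) :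
  forall i j : 'I_n, exists (c0 : int) (c : 'I_n -> int),
    gr_set (P i) * gr_set (P j) =
      (1 : zgroup_ring gT) *~ c0 + \sum_(k < n) gr_set (P k) *~ c k /\
    gr_set (Q i) * gr_set (Q j) =
      (1 : zgroup_ring hT) *~ c0 + \sum_(k < n) gr_set (Q k) *~ c k.
Proof.
move=> i j.
have vE k : pds_v (p k) = #|[set: gT]| by have [<-] := pdsP k.
have [m [r paramP]] := square_params_of_type vE typeP i.
do 2 eexists; split.
  exact: (square_partition_mul partP pdsP paramP).
exact: (square_partition_mul partQ pdsQ paramP).
Qed.
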